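(* For every finite tree $T$, the topological inspection number satisfies $\mathsf{in}_t(T)\le 3$.
   Context: Zero-visibility $k$-search game on a finite simple graph $G$: an invisible intruder occupies a vertex; players alternate starting with the searcher; on each turn the searcher inspects an arbitrary set of $k$ vertices and wins if the intruder is at one of them; otherwise the intruder may move to an adjacent vertex or stay. The inspection number $\mathsf{in}(G)$ is the least $k$ for which the searcher has a finite sequence of moves guaranteeing capture. A subdivision of $G$ is obtained by repeatedly replacing an edge by a path of length two through a new vertex. $\mathsf{in}_t(G)$ is the least $k$ such that every subdivision $H$ of $G$ has a further subdivision $H'$ with $\mathsf{in}(H')\le k$. *)

(* Defs.v *)
From mathcomp Require Import all_boot.
From mathcomp Require Import boolp.

Set Implicit Arguments.
Unset Strict Implicit.
Unset Printing Implicit Defensive.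

Record sgraph := SGraph {
  vertex :> finType;
  adj : rel vertex;
  adj_sym : symmetric adj;
  adj_irrefl : irreflexive adj }.

(* [ucycle adj [:: x; y]] holds as soon as x and y are adjacent, so genuine
   cycles are the ones with at least three vertices. *)
Definition acyclic (G : sgraph) : Prop :=
  forall c : seq G, ucycle (@adj G) c -> size c < 3.

Definition is_tree (G : sgraph) : Prop :=
  [/\ 0 < #|G|, forall x y : G, connect (@adj G) x y & acyclic G].

(* The intruder is invisible, so a strategy of the searcher is a sequence of
   sets fixed in advance, and a play of the intruder is a lazy walk: [w i] is
   the intruder's vertex at the time of the searcher's (i+1)-st inspection. *)
Definition lazy_walk (G : sgraph) (w : nat -> G) : Prop :=
  forall i, w i.+1 = w i \/ adj (w i) (w i.+1).

Definition captures (G : sgraph) (s : seq {set G}) (w : nat -> G) : Prop :=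
  exists2 i, i < size s & w i \in nth set0 s i.

Definition searcher_wins (G : sgraph) (k : nat) : Prop :=
  exists2 s : seq {set G},
    forall A, A \in s -> #|A| = k &
    forall w : nat -> G, lazy_walk w -> captures s w.

Lemma ex_searcher_wins (G : sgraph) : exists k, `[< searcher_wins G k >].
Proof.
exists #|G|; apply/asboolP; exists [:: setT].
  by move=> A; rewrite inE => /eqP ->; rewrite cardsT.
by move=> w _; exists 0; rewrite //= in_setT.
Qed.

Definition inspection_number (G : sgraph) : nat := ex_minn (ex_searcher_wins G).

(* In [subdivide x y], the edge xy is replaced by the path Some x, None,
   Some y. *)
Section Subdivide.
Variables (G : sgraph) (x y : G).

Definition subdivide_adj (a b : option G) : bool :=
  match a, b with
  | Some u, Some v =>
      adj u v && ~~ ((u == x) && (v == y) || (u == y) && (v == x))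
  | Some u, None | None, Some u => (u == x) || (u == y)
  | None, None => false
  end.

Lemma subdivide_adj_sym : symmetric subdivide_adj.
Proof.
move=> [u|] [v|] //=; rewrite adj_sym; congr (_ && ~~ _).
by rewrite orbC; congr (_ || _); exact: andbC.
Qed.

Lemma subdivide_adj_irrefl : irreflexive subdivide_adj.
Proof. by case=> [u|] //=; rewrite adj_irrefl. Qed.

Definition subdivide : sgraph :=
  @SGraph (option G) subdivide_adj subdivide_adj_sym subdivide_adj_irrefl.

End Subdivide.

(* Subdivisions are built on canonical vertex types; this loses nothing, as the
   inspection number is invariant under isomorphism. *)
Inductive subdivision (G : sgraph) : sgraph -> Prop :=
| subdivision_refl : subdivision G G
| subdivision_step (H : sgraph) (x y : H) :
    subdivision G H -> adj x y -> subdivision G (subdivide x y).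

Definition topologically_inspectable (G : sgraph) (k : nat) : Prop :=
  forall H : sgraph, subdivision G H ->
  exists2 H' : sgraph, subdivision H H' & inspection_number H' <= k.

(* in_t as a graph relation rather than a function: "in_t(G) <= m" is stated
   with an existential, so that it includes the existence of the minimum. *)
Definition is_topological_inspection_number (G : sgraph) (k : nat) : Prop :=
  topologically_inspectable G k /\
  forall j, topologically_inspectable G j -> k <= j.

(* Main.v *)
(* Three inspections hold a vertex and push the intruder back along a path at
   speed 1. A rooted tree with fully clean branches, held at its root, may be
   abandoned for N steps: the contamination only enters the ball of radius N
   around the root, which is a spider if the edges there were subdivided often
   enough, and it can be cleaned again, leg by leg, while holding the root. So
   if the tree is A with the tree B hung at its root a, clean A first, then
   forget about A while cleaning B and the path between B and a, hold a, and
   clean A again. The lengths are chosen recursively: first B, then the path,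
   and finally A, which has to withstand the time spent on B and the path. *)
Require Import Defs.
From mathcomp Require Import all_boot.
From mathcomp Require boolp.

Set Implicit Arguments.
Unset Strict Implicit.
Unset Printing Implicit Defensive.

(** * Isomorphisms and their effect on subdivision *)

Definition is_iso (A B : sgraph) (f : A -> B) : Prop :=
  bijective f /\ forall x y, adj (f x) (f y) = adj x y.

Lemma is_iso_id (A : sgraph) : is_iso (@id A).
Proof. by split=> //; exists id. Qed.

Lemma is_iso_comp (A B C : sgraph) (f : B -> C) (g : A -> B) :
  is_iso f -> is_iso g -> is_iso (f \o g).
Proof.
move=> [f_bij f_adj] [g_bij g_adj]; split; first exact: bij_comp.
by move=> x y /=; rewrite f_adj g_adj.
Qed.

Lemma is_iso_can (A B : sgraph) (f : A -> B) (g : B -> A) :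
  is_iso f -> cancel f g -> is_iso g.
Proof.
move=> [f_bij f_adj] fK; have gf : cancel g f by apply/(bij_can_sym f_bij).
by split=> [|x y]; [exists f | rewrite -{2}[x]gf -{2}[y]gf f_adj].
Qed.

Lemma is_iso_subdivide (A B : sgraph) (f : A -> B) (x y : A) :
  is_iso f ->
  is_iso (omap f : subdivide x y -> subdivide (f x) (f y)).
Proof.
move=> [f_bij f_adj]; have f_inj := bij_inj f_bij; split.
  case: f_bij => g fK gK; exists (omap g) => -[u|] //=; by rewrite ?fK ?gK.
by move=> [u|] [v|]; rewrite /= /subdivide_adj ?f_adj ?(inj_eq f_inj).
Qed.

Lemma is_iso_subdivideC (A : sgraph) (x y : A) :
  is_iso (id : subdivide x y -> subdivide y x).
Proof.
split; first by exists id.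
move=> [u|] [v|] //=; last 2 first.
- by rewrite /= orbC.
- by rewrite /= orbC.
by rewrite [X in ~~ X]orbC.
Qed.

(** * Joins, rooted trees and rooted subdivisions *)

Section Join.
Variables (A B : sgraph) (a : A) (b : B).

Definition join_adj (u v : A + B) : bool :=
  match u, v with
  | inl x, inl y => adj x y
  | inr x, inr y => adj x y
  | inl x, inr y | inr y, inl x => (x == a) && (y == b)
  end.

Lemma join_adj_sym : symmetric join_adj.
Proof. by move=> [x|x] [y|y] //=; rewrite adj_sym. Qed.

Lemma join_adj_irrefl : irreflexive join_adj.
Proof. by case=> x /=; rewrite adj_irrefl. Qed.

Definition join : sgraph := SGraph join_adj_sym join_adj_irrefl.

End Join.

Definition point : sgraph :=
  @SGraph unit (fun _ _ => false) (fun _ _ => erefl) (fun _ => erefl).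

(** Rooted trees, generated by hanging one at the root of another along a new edge. Closure under
    isomorphism absorbs the changes of vertex type made by [subdivide] and by splitting a tree. *)
Inductive built : forall G : sgraph, G -> Prop :=
| built_point : @built point tt
| built_join (A B : sgraph) (a : A) (b : B) :
    built a -> built b -> @built (join a b) (inl a)
| built_iso (A B : sgraph) (f : A -> B) (a : A) :
    is_iso f -> built a -> built (f a).

(** The root is followed through the subdivision, and closure under isomorphism lets subdivisions of
    the parts be carried out inside a join. *)
Inductive rooted_subdivision (A : sgraph) (a : A) :
    forall B : sgraph, B -> Prop :=
| rooted_subdivision_refl : rooted_subdivision a a
| rooted_subdivision_step (B : sgraph) (b x y : B) :
    rooted_subdivision a b -> adj x y ->
    @rooted_subdivision _ a (subdivide x y) (Some b)
| rooted_subdivision_iso (B C : sgraph) (f : B -> C) (b : B) :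
    is_iso f -> rooted_subdivision a b -> rooted_subdivision a (f b).

Lemma rooted_subdivision_trans (A B C : sgraph) (a : A) (b : B) (c : C) :
  rooted_subdivision a b -> rooted_subdivision b c -> rooted_subdivision a c.
Proof.
move=> ab; elim=> // [D d x y _ IH|D E f d].
  exact: rooted_subdivision_step.
by move=> f_iso _; apply: rooted_subdivision_iso.
Qed.

Lemma iso_rooted_subdivision (A B C : sgraph) (f : A -> B) (a : A) (c : C) :
  is_iso f -> rooted_subdivision a c -> rooted_subdivision (f a) c.
Proof.
move=> f_iso; apply: rooted_subdivision_trans.
have [[g fK gK] _] := f_iso; rewrite -{2}[a]fK.
apply: rooted_subdivision_iso; first exact: is_iso_can fK.
exact: rooted_subdivision_refl.
Qed.

(** All isomorphisms can be moved to the end: an edge of [B] is pulled back along [f] and subdivided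
    there. *)
Lemma rooted_subdivisionW (A B : sgraph) (a : A) (b : B) :
  rooted_subdivision a b ->
  exists (H : sgraph) (f : H -> B), subdivision A H /\ is_iso f.
Proof.
elim=> [|{}B {}b x y _ [H [f [sub_H f_iso]]] xy|{}B C f {}b f_iso _].
- by exists A, id; split; [exact: subdivision_refl | exact: is_iso_id].
- have [[g fK gK] f_adj] := f_iso; rewrite -[x]gK -[y]gK in xy *.
  exists (subdivide (g x) (g y)), (omap f).
  split; last exact: is_iso_subdivide.
  by apply: subdivision_step; rewrite // -f_adj.
move=> [H [g [sub_H g_iso]]]; exists H, (f \o g).
by split; last exact: is_iso_comp.
Qed.

(** * Subdividing an edge of a join *)

Section JoinIso.
Variables (A B : sgraph) (a : A) (b : B).

Lemma is_iso_joinl (A' : sgraph) (f : A -> A') :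
  is_iso f ->
  is_iso (fun z : join a b =>
            match z with inl x => inl (f x) | inr y => inr y end : join (f a) b).
Proof.
move=> [[g fK gK] f_adj]; split.
  exists (fun z => match z with inl x => inl (g x) | inr y => inr y end);
    by move=> [x|x]; rewrite ?fK ?gK.
by move=> [x|x] [y|y]; rewrite //= ?f_adj ?(can_eq fK).
Qed.

Lemma is_iso_joinr (B' : sgraph) (f : B -> B') :
  is_iso f ->
  is_iso (fun z : join a b =>
            match z with inl x => inl x | inr y => inr (f y) end : join a (f b)).
Proof.
move=> [[g fK gK] f_adj]; split.
  exists (fun z => match z with inl x => inl x | inr y => inr (g y) end);
    by move=> [x|x]; rewrite ?fK ?gK.
by move=> [x|x] [y|y]; rewrite //= ?f_adj ?(can_eq fK).
Qed.

Lemma is_iso_subdivide_joinl (x y : A) :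
  is_iso (fun z : @subdivide (join a b) (inl x) (inl y) =>
    match z with
    | Some (inl u) => inl (Some u)
    | Some (inr v) => inr v
    | None => inl None
    end : @join (subdivide x y) B (Some a) b).
Proof.
split.
  exists (fun z => match z with
    | inl (Some u) => Some (inl u)
    | inr v => Some (inr v)
    | inl None => None
    end); first by move=> [[u|v]|].
  by move=> [[u|]|v].
by move=> [[u|u]|] [[v|v]|]; rewrite //= ?andbF //= ?andbT ?(inj_eq Some_inj).
Qed.

Lemma is_iso_subdivide_joinr (x y : B) :
  is_iso (fun z : @subdivide (join a b) (inr x) (inr y) =>
    match z with
    | Some (inl u) => inl u
    | Some (inr v) => inr (Some v)
    | None => inr None
    end : @join A (subdivide x y) a (Some b)).
Proof.
split.
  exists (fun z => match z with
    | inr (Some u) => Some (inr u)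
    | inl v => Some (inl v)
    | inr None => None
    end); first by move=> [[u|v]|].
  by move=> [u|[v|]].
by move=> [[u|u]|] [[v|v]|]; rewrite //= ?andbF //= ?andbT ?(inj_eq Some_inj).
Qed.

(** The new vertex becomes a one-vertex tree carrying [B], so subdividing the joining edge lengthens
    the branch by one vertex at its root. *)
Lemma is_iso_subdivide_join_edge :
  is_iso (fun z : @subdivide (join a b) (inl a) (inr b) =>
    match z with
    | Some (inl u) => inl u
    | Some (inr v) => inr (inr v)
    | None => inr (inl tt)
    end : @join A (@join point B tt b) a (inl tt)).
Proof.
split.
  exists (fun z => match z with
    | inl u => Some (inl u)
    | inr (inr v) => Some (inr v)
    | inr (inl _) => None
    end); first by move=> [[u|v]|].
  by move=> [u|[[]|v]].
move=> [[u|u]|] [[v|v]|]; rewrite //= ?andbF //= ?andbT ?orbF //=.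
- exact/esym/andbN.
- rewrite [X in ~~ X]andbC; exact/esym/andbN.
Qed.

End JoinIso.

Lemma rooted_subdivision_joinl (A A' B : sgraph) (a : A) (a' : A') (b : B) :
  rooted_subdivision a a' ->
  @rooted_subdivision (join a b) (inl a) (join a' b) (inl a').
Proof.
elim=> [|C c x y _ IH xy|C D f c f_iso _ IH].
- exact: rooted_subdivision_refl.
- have st := rooted_subdivision_step IH (xy : adj (inl x : join c b) (inl y)).
  exact: (rooted_subdivision_iso (is_iso_subdivide_joinl c b x y) st).
- exact: (rooted_subdivision_iso (is_iso_joinl c b f_iso) IH).
Qed.

Lemma rooted_subdivision_joinr (A B B' : sgraph) (a : A) (b : B) (b' : B') :
  rooted_subdivision b b' ->
  @rooted_subdivision (join a b) (inl a) (join a b') (inl a).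
Proof.
elim=> [|C c x y _ IH xy|C D f c f_iso _ IH].
- exact: rooted_subdivision_refl.
- have st := rooted_subdivision_step IH (xy : adj (inr x : join a c) (inr y)).
  exact: (rooted_subdivision_iso (is_iso_subdivide_joinr a c x y) st).
- exact: (rooted_subdivision_iso (is_iso_joinr a c f_iso) IH).
Qed.

Lemma rooted_subdivision_join_edge (A B : sgraph) (a : A) (b : B) :
  @rooted_subdivision (join a b) (inl a)
    (join a (inl tt : @join point B tt b)) (inl a).
Proof.
have edge : adj (inl a : join a b) (inr b) by rewrite /= !eqxx.
have st := rooted_subdivision_step (rooted_subdivision_refl _) edge.
exact: (rooted_subdivision_iso (is_iso_subdivide_join_edge a b) (st _)).
Qed.

Lemma built_iso_inv (A B : sgraph) (f : A -> B) (a : A) :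
  is_iso f -> built (f a) -> built a.
Proof.
move=> f_iso; have [[g fK gK] _] := f_iso; rewrite -{2}[a]fK.
by apply: built_iso; exact: is_iso_can fK.
Qed.

(** Edges inside a part are left to the induction. Subdividing the joining edge hangs [B] at a new
    point and that point at [a], which takes two joins. *)
Lemma built_subdivide (A : sgraph) (a : A) :
  built a -> forall x y : A, adj x y -> @built (subdivide x y) (Some a).
Proof.
elim=> [//|{}A B {}a b a_built IHa b_built IHb|{}A B f {}a f_iso _ IH] x y.
  have edge (u : A) (v : B) : adj (inl u : join a b) (inr v) ->
      @built (@subdivide (join a b) (inl u) (inr v)) (Some (inl a)).
    move=> /= /andP[/eqP-> /eqP->].
    apply: (built_iso_inv (is_iso_subdivide_join_edge a b)).
    by do 2?apply: built_join => //; exact: built_point.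
  case: x y => [x|x] [y|y] xy.
  - apply: (built_iso_inv (is_iso_subdivide_joinl a b x y)).
    by apply: built_join => //; exact: IHa.
  - exact: edge.
  - apply: (built_iso_inv (is_iso_subdivideC (inr x : join a b) (inl y))).
    exact: edge.
  - apply: (built_iso_inv (is_iso_subdivide_joinr a b x y)).
    by apply: built_join => //; exact: IHb.
have [[g fK gK] f_adj] := f_iso; rewrite -[x]gK -[y]gK f_adj => xy.
have f_iso' := is_iso_subdivide (g x) (g y) f_iso.
exact: (@built_iso _ _ _ (Some a : subdivide (g x) (g y)) f_iso' (IH _ _ xy)).
Qed.

Lemma built_subdivision (A H : sgraph) :
  subdivision A H -> (exists a : A, built a) -> exists h : H, built h.
Proof.
elim=> [//|{}H x y _ IH xy] /IH[h h_built].
by exists (Some h); exact: built_subdivide.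
Qed.

(** * Spread of contamination under inspections *)

Section Inspection.
Variable G : sgraph.
Implicit Types (X Y C o : {set G}) (s : seq {set G}) (r : G).

Definition spread C : {set G} :=
  [set y | [exists x in C, (x == y) || adj x y]].

(* C is the set of contaminated vertices, i.e. of possible positions of the
   intruder, and contamination keeps entering from outside at the vertices
   of o. *)
Definition step o C X : {set G} := o :|: spread (C :\: X).

Definition after o C s : {set G} := foldl (step o) C s.

(** The closed metric ball, written as [n] uninspected steps so that it compares directly with
    [after]. *)
Definition ball r n : {set G} := iter n (fun C => step [set r] C set0) [set r].

Lemma spreadS C C' : C \subset C' -> spread C \subset spread C'.
Proof.
move=> /subsetP sub; apply/subsetP=> y; rewrite !inE.
case/existsP=> x /andP[/sub xC' xy].
by apply/existsP; exists x; rewrite xC'.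
Qed.

Lemma spread0 : spread set0 = set0.
Proof.
by apply/setP=> y; rewrite !inE; apply/existsP=> -[x]; rewrite inE.
Qed.

Lemma stepS o o' C C' X X' :
  o \subset o' -> C \subset C' -> X' \subset X ->
  step o C X \subset step o' C' X'.
Proof. by move=> oo CC XX; apply: setUSS => //; apply/spreadS/setDSS. Qed.

Lemma afterS o o' C C' s :
  o \subset o' -> C \subset C' -> after o C s \subset after o' C' s.
Proof. by move=> oo; elim: s C C' => //= X s IH C C' CC; exact/IH/stepS. Qed.

Lemma after_cat o C s s' : after o C (s ++ s') = after o (after o C s) s'.
Proof. exact: foldl_cat. Qed.

(** Inspections can only remove contamination, so the radius grows by at most one per turn. *)
Lemma after_ball r n s : after [set r] (ball r n) s \subset ball r (n + size s).
Proof.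
elim: s n => [|X s IH] n /=; first by rewrite addn0.
rewrite addnS -addSn; apply: subset_trans (IH n.+1).
by apply: afterS => //; apply: stepS; rewrite ?sub0set.
Qed.

Lemma ball_sub r m n : m <= n -> ball r m \subset ball r n.
Proof.
move=> /subnK<-; elim: (n - m) => //= k IH; apply: (subset_trans IH).
apply/subsetP=> x xb; rewrite !inE; apply/orP; right.
by apply/existsP; exists x; rewrite !inE xb eqxx.
Qed.

(* In the next three definitions the rest of the graph is hidden behind r, which
   stays contaminated throughout. *)
Definition cleanable r t : Prop :=
  exists s, [/\ size s = t, forall X, X \in s -> #|X| <= 3 &
                after [set r] setT s \subset [set r]].

(* The bound 2 leaves one inspection to hold a vertex elsewhere. *)
Definition pushable r n : Prop :=
  exists s, [/\ size s = n, forall X, X \in s -> #|X| <= 2 &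
                after [set r] (ball r n) s \subset [set r]].

Definition restorable r n : Prop :=
  exists s, (forall X, X \in s -> (#|X| <= 3) && (r \in X)) /\
            after [set r] (ball r n) s \subset [set r].

Lemma restorable_le r m n : m <= n -> restorable r n -> restorable r m.
Proof.
move=> mn [s [s_card s_clean]]; exists s; split=> //.
by apply: subset_trans s_clean; apply: afterS; rewrite ?ball_sub.
Qed.

End Inspection.

(** * Contamination in a join *)

Section JoinInspection.
Variables (A B : sgraph) (a : A) (b : B).
Local Notation J := (join a b).

Definition sumset (X : {set A}) (Y : {set B}) : {set J} :=
  [set z : J | match z with inl x => x \in X | inr y => y \in Y end].

Lemma sumsetS (X X' : {set A}) (Y Y' : {set B}) :
  X \subset X' -> Y \subset Y' -> sumset X Y \subset sumset X' Y'.
Proof.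
by move=> /subsetP XX /subsetP YY; apply/subsetP=> -[x|y]; rewrite !inE;
  [exact: XX | exact: YY].
Qed.

Lemma sumset_set1 : [set inl a : J] = sumset [set a] set0.
Proof. by apply/setP=> -[x|y]; rewrite !inE. Qed.

Lemma sumset_setT : sumset setT setT = setT.
Proof. by apply/setP=> -[x|y]; rewrite !inE. Qed.

Lemma card_sumset (X : {set A}) (Y : {set B}) : #|sumset X Y| <= #|X| + #|Y|.
Proof.
have -> : sumset X Y = (@inl A B @: X) :|: (@inr A B @: Y).
  apply/setP=> -[x|y]; rewrite !inE ?(mem_imset_eq _ _ inl_inj).
    by rewrite mem_imset; [rewrite orbC; case: imsetP => // -[]|exact: inl_inj].
  by rewrite mem_imset; [case: imsetP => // -[]|exact: inr_inj].
apply: leq_trans (leq_card_setU _ _) _.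
by apply: leq_add; exact: leq_imset_card.
Qed.

(* Inspecting a disconnects the two sides, so the B-side then needs no outside
   contamination. *)
Lemma step_join (X U : {set A}) (Y V oB : {set B}) :
  a \in U \/ oB = [set b] ->
  step [set inl a : J] (sumset X Y) (sumset U V)
    \subset sumset (step [set a] X U) (step oB Y V).
Proof.
move=> oBP; apply/subsetP=> z; rewrite !inE => /orP[/eqP->|].
  by rewrite !inE eqxx.
case/existsP=> w; rewrite !inE.
case: z w => [z|z] [w|w] /andP[/andP[wU wX]] wz.
- by rewrite !inE; apply/orP; right; apply/existsP; exists w; rewrite !inE wU wX.
- by move: wz => /= /andP[/eqP-> _]; rewrite !inE eqxx.
- move: wz => /= /andP[/eqP wa /eqP->]; rewrite wa in wU.
  case: oBP => [aU|->]; first by rewrite aU in wU.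
  by rewrite !inE eqxx.
- by rewrite !inE; apply/orP; right; apply/existsP; exists w; rewrite !inE wU wX.
Qed.

Lemma after_join (X : {set A}) (Y oB : {set B}) (s : seq ({set A} * {set B})) :
  (forall p, p \in s -> a \in p.1) \/ oB = [set b] ->
  after [set inl a : J] (sumset X Y) [seq sumset p.1 p.2 | p <- s]
    \subset sumset (after [set a] X (unzip1 s)) (after oB Y (unzip2 s)).
Proof.
elim: s X Y => //= p s IH X Y oBP.
have oBP' : (forall q, q \in s -> a \in q.1) \/ oB = [set b].
  case: oBP => [ap|->]; [left=> q qs|by right].
  by apply: ap; rewrite inE qs orbT.
apply: subset_trans (IH _ _ oBP'); apply: (@afterS J) => //; apply: step_join.
by case: oBP => [ap|->]; [left; apply: ap; rewrite mem_head|right].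
Qed.

(** Crossing the edge [ab] costs one step, so contamination coming from [a] lags by one on the side
    of [b]. *)
Lemma ball_join n : ball (inl a : J) n.+1 \subset sumset (ball a n.+1) (ball b n).
Proof.
have set00 : set0 = sumset set0 set0 by apply/setP=> -[x|y]; rewrite !inE.
elim: n => [|n IH].
  rewrite /ball /= {2}sumset_set1 set00.
  apply: subset_trans (step_join _ _ _ (or_intror erefl)) _.
  by apply: sumsetS => //; rewrite /step setD0 spread0 setU0.
apply: subset_trans (@stepS J _ _ _ _ _ _ (subxx _) IH (sub0set _)) _.
rewrite set00; exact: (step_join _ _ _ (or_intror erefl)).
Qed.

End JoinInspection.

(** * Strategies on a join *)

Section JoinStrategy.
Variables (A B : sgraph) (a : A) (b : B).

(* The last inspection, of both ends of the edge ab, moves the boundary of the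
   clean part of B from b to a. *)
Lemma after_handover (U : {set A}) (C : {set B}) (s : seq {set B}) m :
  after [set b] C s \subset [set b] ->
  after [set inl a : join a b] (sumset a b (ball a m) C)
      (rcons (map (sumset a b U) s) (sumset a b [set a] [set b]))
    \subset sumset a b (ball a (m + size s).+1) set0.
Proof.
move=> sb; rewrite -cats1 after_cat /=.
have := @after_join A B a b (ball a m) C [set b] [seq (U, V) | V <- s]
  (or_intror erefl).
rewrite /unzip1 /unzip2 -!map_comp /= map_id => le1.
have le2 : sumset a b (after [set a] (ball a m) [seq U | _ <- s])
             (after [set b] C s)
           \subset sumset a b (ball a (m + size s)) [set b].
  apply: sumsetS => //; apply: subset_trans (after_ball _ _ _) _.
  by rewrite size_map.
apply: subset_trans (@stepS (join a b) _ _ _ _ _ _ (subxx _)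
  (subset_trans le1 le2) (subxx _)) _.
have a_in : a \in [set a] by rewrite inE.
apply: subset_trans (@step_join _ _ _ _ _ _ _ _ set0 (or_introl a_in)) _.
apply: sumsetS; first by apply: stepS; rewrite ?sub0set.
by rewrite /step setDv spread0 setU0.
Qed.

(** Every inspection contains [a], so nothing crosses the edge [ab] and [B] stays clean without
    being inspected. *)
Lemma after_hold (C : {set A}) (s : seq {set A}) :
  (forall X, X \in s -> a \in X) ->
  after [set inl a : join a b] (sumset a b C set0)
      (map (fun X => sumset a b X set0) s)
    \subset sumset a b (after [set a] C s) set0.
Proof.
move=> sa.
have pa (p : {set A} * {set B}) : p \in [seq (X, set0) | X <- s] -> a \in p.1.
  by case/mapP=> X /sa aX ->.
have := @after_join A B a b C set0 set0 _ (or_introl pa).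
rewrite /unzip1 /unzip2 -!map_comp /= map_id => le1.
apply: subset_trans le1 _; apply: sumsetS => //.
by elim: s {sa pa} => //= X s IH; rewrite /step setD0 spread0 setU0.
Qed.

Lemma card_sumset_le (X : {set A}) (Y : {set B}) m n :
  #|X| <= m -> #|Y| <= n -> #|sumset a b X Y| <= m + n.
Proof. by move=> Xm Yn; apply: leq_trans (card_sumset _ _ _ _) (leq_add _ _). Qed.

Lemma cleanable_join tA tB :
  cleanable a tA -> cleanable b tB -> restorable a tB.+1 ->
  exists t, cleanable (inl a : join a b) t.
Proof.
move=> [sA [_ cA clA]] [sB [sz cB clB]] [sR [cR clR]].
exists (size (map (fun X => sumset a b X set0) sA ++
  rcons (map (sumset a b set0) sB) (sumset a b [set a] [set b]) ++
  map (fun X => sumset a b X set0) sR)); eexists; split; first by [].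
  move=> X; rewrite !mem_cat mem_rcons inE -!orbA => /or4P[].
  - case/mapP=> Y /cA Y3 ->; rewrite -[3]addn0.
    by apply: card_sumset_le; rewrite ?cards0.
  - by move/eqP->; apply: leq_trans (card_sumset_le (leqnn _) (leqnn _)) _;
      rewrite !cards1.
  - case/mapP=> Y /cB Y3 ->; rewrite -[3]add0n.
    by apply: card_sumset_le; rewrite ?cards0.
  - case/mapP=> Y /cR/andP[Y3 _] ->; rewrite -[3]addn0.
    by apply: card_sumset_le; rewrite ?cards0.
rewrite !after_cat.
have le1 : after [set inl a : join a b] setT
    (map (fun X => sumset a b X set0) sA) \subset sumset a b (ball a 0) setT.
  have := @after_join A B a b setT setT [set b] [seq (X, set0) | X <- sA]
    (or_intror erefl).
  rewrite /unzip1 /unzip2 -!map_comp /= map_id sumset_setT => le1.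
  by apply: subset_trans le1 _; apply: sumsetS; rewrite ?subsetT.
(* [A] is clean up to [a], hence the initial radius 0. While [B] is cleaned nothing in [A] is
   inspected; the handover adds the last unit of [tB.+1]. *)
have le2 := @after_handover set0 setT sB 0 clB.
rewrite add0n sz in le2.
have aR X : X \in sR -> a \in X by case/cR/andP.
have le3 := after_hold (ball a tB.+1) aR.
apply: subset_trans (@afterS (join a b) _ _ _ _ _ (subxx _)
  (subset_trans (@afterS (join a b) _ _ _ _ _ (subxx _) le1) le2)) _.
by apply: subset_trans le3 _; rewrite (sumset_set1 a b); apply: sumsetS.
Qed.

(** One inspection holds [a], as [restorable] demands, and two push [B] back. Meanwhile the ball of
    radius [n] in [A] spreads for [n] steps and one more for the handover, whence [(n + n).+1]. *)
Lemma restorable_join n :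
  pushable b n -> restorable a (n + n).+1 -> restorable (inl a : join a b) n.
Proof.
move=> [sB [sz cB clB]] [sR [cR clR]].
exists (rcons (map (sumset a b [set a]) sB) (sumset a b [set a] [set b]) ++
  map (fun X => sumset a b X set0) sR); split.
  move=> X; rewrite mem_cat mem_rcons inE -!orbA => /or3P[].
  - move/eqP->; rewrite !inE eqxx andbT.
    by apply: leq_trans (card_sumset_le (leqnn _) (leqnn _)) _; rewrite !cards1.
  - case/mapP=> Y /cB Y2 ->; rewrite !inE eqxx andbT -[3]/(1 + 2).
    by apply: card_sumset_le; rewrite ?cards1.
  - case/mapP=> Y /cR/andP[Y3 aY] ->; rewrite inE aY andbT -[3]addn0.
    by apply: card_sumset_le; rewrite ?cards0.
rewrite after_cat.
have le1 : ball (inl a : join a b) n \subset sumset a b (ball a n) (ball b n).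
  case: n {sz clB clR} => [|n]; last first.
    apply: subset_trans (ball_join _ _ _) _; apply: sumsetS => //.
    exact: ball_sub.
  by rewrite /ball /= {1}(sumset_set1 a b) sumsetS ?sub0set.
have le2 := @after_handover [set a] (ball b n) sB n clB.
rewrite sz in le2.
have aR X : X \in sR -> a \in X by case/cR/andP.
have le3 := after_hold (ball a (n + n).+1) aR.
apply: subset_trans (@afterS (join a b) _ _ _ _ _ (subxx _)
  (subset_trans (@afterS (join a b) _ _ _ _ _ (subxx _) le1) le2)) _.
by apply: subset_trans le3 _; rewrite (sumset_set1 a b); apply: sumsetS.
Qed.

End JoinStrategy.

(** * Arms and the recursive choice of lengths *)

Section Arm.
Variables (B : sgraph) (b : B).
Local Notation tip := (inl tt : @join point B tt b).

(** This is the handover with a single point as [A]: all of that side is its root, so only the tip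
    remains contaminated. *)
Lemma after_tip (C : {set B}) (D : {set @join point B tt b}) s :
  after [set b] C s \subset [set b] -> D \subset sumset (tt : point) b setT C ->
  after [set tip] D
    (rcons (map (sumset (tt : point) b set0) s)
       (sumset (tt : point) b [set tt : point] [set b]))
    \subset [set tip].
Proof.
move=> sb DC; have le := @after_handover point B tt b set0 C s 0 sb.
apply: subset_trans (subset_trans (@afterS (@join point B tt b) _ _ _ _ _
  (subxx _) _) le) _.
  apply: subset_trans DC _; apply: sumsetS => //.
  by apply/subsetP=> -[] _; rewrite inE.
by rewrite sumset_set1; apply: sumsetS => //; apply/subsetP=> -[] _; rewrite inE.
Qed.

Lemma card_tip (s : seq {set B}) k X :
  2 <= k -> (forall Y, Y \in s -> #|Y| <= k) ->
  X \in rcons (map (sumset (tt : point) b set0) s)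
          (sumset (tt : point) b [set tt : point] [set b]) ->
  #|X| <= k.
Proof.
move=> k2 sk; rewrite mem_rcons inE => /predU1P[->|/mapP[Y /sk Yk ->]].
  apply: leq_trans (card_sumset_le _ _ (leqnn _) (leqnn _)) _.
  by rewrite !cards1.
by rewrite -[k]add0n; apply: card_sumset_le; rewrite ?cards0.
Qed.

Lemma cleanable_tip t : cleanable b t -> cleanable tip t.+1.
Proof.
move=> [s [sz c3 cl]]; eexists; split; last first.
- by apply: after_tip cl _; rewrite sumset_setT.
- by move=> X; apply: card_tip.
- by rewrite size_rcons size_map sz.
Qed.

(** The ball of radius [n.+1] at the tip meets [B] within the ball of radius [n] at [b], and the
    handover is one extra inspection, so time stays equal to radius. *)
Lemma pushable_tip n : pushable b n -> pushable tip n.+1.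
Proof.
move=> [s [sz c2 cl]]; eexists; split; last first.
- apply: after_tip cl _; apply: subset_trans (ball_join _ _ _) _.
  by apply: sumsetS; rewrite ?subsetT.
- by move=> X; apply: card_tip.
- by rewrite size_rcons size_map sz.
Qed.

End Arm.

(** The ball of radius [n] around the end of an arm with [n] new vertices reaches no further than
    [b], so it is pushed back whatever [B] is. Quantifying over [A] lets the arm be fixed before [A]
    is subdivided. *)
Lemma exists_arm (B : sgraph) (b : B) t n :
  cleanable b t ->
  exists (B' : sgraph) (b' : B'),
    [/\ forall (A : sgraph) (a : A),
          @rooted_subdivision (join a b) (inl a) (join a b') (inl a),
        cleanable b' (t + n) & pushable b' n].
Proof.
move=> b_clean; elim: n => [|n [B' [b' [sub clean push]]]].
  exists B, b; rewrite addn0; split=> //.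
    by move=> A a; exact: rooted_subdivision_refl.
  by exists [::].
exists (@join point B' tt b'), (inl tt); rewrite addnS; split.
- move=> A a; apply: rooted_subdivision_trans (sub A a) _.
  exact: rooted_subdivision_join_edge.
- exact: cleanable_tip.
- exact: pushable_tip.
Qed.

(** The radius [n] is quantified inside the induction, so that [A] can be asked for a radius
    computed from the time spent on [B] and its arm. *)
Lemma built_cleanable (A : sgraph) (a : A) :
  built a -> forall n, exists (A' : sgraph) (a' : A') t,
    [/\ rooted_subdivision a a', cleanable a' t & restorable a' n].
Proof.
elim=> [|{}A B {}a b _ IHa _ IHb|{}A B f {}a f_iso _ IH] n.
- exists point, tt, 0; split; first exact: rooted_subdivision_refl.
    by exists [::]; split=> //; apply/subsetP=> -[] _; rewrite inE.
  by exists [::]; split=> //; apply/subsetP=> -[] _; rewrite inE.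
(* The ball of radius [n] will end on the arm, so radius 0 is enough for [B]. *)
- have [B1 [b1 [t [sub_b clean_b _]]]] := IHb 0.
  have [B2 [b2 [sub_arm clean_arm push_arm]]] := exists_arm n clean_b.
  (* The first radius covers the time [t + n] for cleaning [B] with its arm, plus the handover, in
     [cleanable_join]; the second serves [restorable_join]. *)
  have [A' [a' [tA [sub_a clean_a rest_a]]]] :=
    IHa (maxn (t + n).+1 (n + n).+1).
  have [t' clean'] : exists t', cleanable (inl a' : join a' b2) t'.
    apply: cleanable_join clean_a clean_arm _.
    by apply: restorable_le rest_a; rewrite leq_maxl.
  exists (join a' b2), (inl a'), t'; split=> //.
    apply: rooted_subdivision_trans (rooted_subdivision_joinl b sub_a) _.
    apply: rooted_subdivision_trans (rooted_subdivision_joinr a' sub_b) _.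
    exact: sub_arm.
  apply: restorable_join push_arm _.
  by apply: restorable_le rest_a; rewrite leq_maxr.
- have [A' [a' [t [sub clean rest]]]] := IH n.
  by exists A', a', t; split=> //; exact: iso_rooted_subdivision sub.
Qed.

(** * Splitting a tree at an edge *)

Section Induced.
Variables (G : sgraph) (S : {set G}).

Definition induced : sgraph :=
  @SGraph {x : G | x \in S} (fun x y => adj (val x) (val y))
    (fun x y => adj_sym (val x) (val y)) (fun x => adj_irrefl (val x)).

Lemma induced_acyclic : acyclic G -> acyclic induced.
Proof.
move=> G_ac c; rewrite -(size_map val c) /ucycle => /andP[c_cyc c_uniq].
apply: G_ac; rewrite /ucycle map_inj_uniq ?c_uniq ?andbT; last exact: val_inj.
by rewrite cycle_map.
Qed.

End Induced.

(** [e] will be adjacency with one edge deleted. An [e]-path from [r] never leaves the component, so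
    it connects inside the induced graph. *)
Lemma induced_component_tree (G : sgraph) (e : rel G) (r : G) :
  symmetric e -> subrel e (@adj G) -> acyclic G ->
  is_tree (induced [set x | connect e r x]).
Proof.
move=> e_sym e_adj G_ac; set S := [set x | _].
have rS : r \in S by rewrite inE connect0.
pose a : induced S := exist _ r rS.
have path_conn p (y z : induced S) : path e (val y) p ->
    val z = last (val y) p -> connect (@adj (induced S)) y z.
  elim: p y => [|x p IH] y /=; first by move=> _ /val_inj ->.
  case/andP=> yx xp zx; have xS : x \in S.
    by move: (valP y); rewrite !inE => /connect_trans; apply; exact: connect1.
  have := IH (exist _ x xS) xp zx; apply: connect_trans.
  by apply: connect1; exact: e_adj.
have conn (x : induced S) : connect (@adj (induced S)) a x.
  have := valP x; rewrite inE => /connectP[p rp xp].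
  exact: (path_conn p a x rp xp).
split; last exact: induced_acyclic.
  by apply/card_gt0P; exists a.
move=> x y; have sym := sym_connect_sym (@adj_sym (induced S)).
by apply: connect_trans (conn y); rewrite sym.
Qed.

(** Deleting an edge [rs] at the root leaves two smaller trees, rooted at [r] and [s], whose join is
    [T]. *)
Lemma tree_built (T : sgraph) (r : T) : is_tree T -> built r.
Proof.
have [n] := ubnP #|T|; elim: n T r => // n IH T r Tn [_ T_conn T_ac].
case: (pickP (adj r)) => [s rs|r_iso]; last first.
  have all_r x : r = x.
    have /connectP[[|y p] /=] := T_conn r x; first by [].
    by rewrite r_iso.
  apply: (@built_iso point T (fun=> r) tt _ built_point); split.
    by exists (fun=> tt) => [[]|].
  by move=> x y; rewrite adj_irrefl.
pose e x y := adj x y && ~~ ((x == r) && (y == s) || (x == s) && (y == r)).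
have e_sym : symmetric e.
  move=> x y; rewrite /e adj_sym; congr (_ && ~~ _).
  by rewrite orbC; congr (_ || _); exact: andbC.
have e_adj : subrel e (@adj T) by move=> x y /andP[].
have r_neq_s : r != s by apply: contraTneq rs => ->; rewrite adj_irrefl.
(* An [e]-path from [r] to [s] avoids the edge [rs], so closing it up with that edge would give a
   cycle on at least three vertices. *)
have r_s : ~~ connect e r s.
  apply/negP=> /connectP[p0 /shortenP[p rp p_uniq _] s_last].
  have: ucycle (@adj T) (r :: p).
    rewrite /ucycle p_uniq andbT /= rcons_path (sub_path e_adj rp).
    by rewrite -s_last adj_sym.
  move/T_ac; case: p rp p_uniq s_last => [|y [|//]] /= rp _ sy _.
    by rewrite sy eqxx in r_neq_s.
  by move: rp; rewrite -sy /e !eqxx andbF.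
(* Crossing the deleted edge lands on [r] or [s], so the end of the path is still covered. *)
have path_cover p y : connect e r y || connect e s y -> path (@adj T) y p ->
    connect e r (last y p) || connect e s (last y p).
  elim: p y => [|z p IHp] y //= ry /andP[yz]; apply: IHp.
  have [ez|] := boolP (e y z).
    by case/orP: ry => /connect_trans/(_ (connect1 ez)) ->; rewrite ?orbT.
  by rewrite /e yz negbK => /orP[]/andP[_ /eqP->]; rewrite connect0 ?orbT.
have cover x : connect e r x || connect e s x.
  have /connectP[p rp ->] := T_conn r x.
  by apply: path_cover; rewrite ?connect0.
pose SA := [set x | connect e r x]; pose SB := [set x | connect e s x].
have disj x : x \in SA -> x \in SB -> false.
  rewrite !inE => rx sx; rewrite -(negbTE r_s); apply: connect_trans rx _.
  by rewrite (sym_connect_sym e_sym).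
have rA : r \in SA by rewrite inE connect0.
have sB : s \in SB by rewrite inE connect0.
have lt_n (S : {set T}) x : x \notin S -> #|induced S| < n.
  move=> xS; rewrite card_sig; apply: (@leq_trans #|T|); last by rewrite -ltnS.
  by apply: proper_card; apply/properP; split; [apply/subsetP | exists x].
have rB : r \notin SB by apply/negP=> /(disj _ rA).
have sA : s \notin SA by apply/negP=> /disj /(_ sB).
pose a : induced SA := exist _ r rA; pose b : induced SB := exist _ s sB.
have a_built : built a.
  apply: (IH (induced SA) a (lt_n _ _ sA)).
  exact: induced_component_tree.
have b_built : built b.
  apply: (IH (induced SB) b (lt_n _ _ rB)).
  exact: induced_component_tree.
pose f (z : join a b) : T := match z with inl u => val u | inr v => val v end.
apply: (@built_iso _ _ f (inl a)); last exact: built_join.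
(* An edge between the sides other than [rs] would be an [e]-edge and merge the two components. *)
have cross (u : induced SA) (v : induced SB) :
    adj (val u) (val v) = (u == a) && (v == b).
  rewrite -!(inj_eq val_inj) /=; apply/idP/andP=> [uv|[/eqP-> /eqP->]] //.
  have uA : val u \in SA := valP u; have vB : val v \in SB := valP v.
  have: ~~ e (val u) (val v).
    apply/negP=> euv; have vA : val v \in SA.
      by move: uA; rewrite !inE => /connect_trans; apply; exact: connect1.
    by have := disj _ vA vB.
  rewrite /e uv negbK => /orP[/andP[-> ->]//|/andP[/eqP us _]].
  by move: uA; rewrite us (negbTE sA).
split.
  (* The default [inl a] is never reached, because the two sides cover [T]. *)
  exists (fun x => if (insub x : option {y | y \in SA}) is Some u
    then (inl u : join a b)
    else if (insub x : option {y | y \in SB}) is Some v then inr v else inl a).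
    case=> [u|v] /=; first by rewrite valK.
    rewrite insubN ?valK //; apply/negP=> vA.
    by have := disj _ vA (valP v).
  move=> x; case: insubP => [u _ //|xA]; case: insubP => [v _ //|xB].
  by move: (cover x) xA xB; rewrite !inE; case/orP=> ->.
case=> [u|u] [v|v] //=; first exact: cross.
rewrite adj_sym; exact: cross.
Qed.

(** * From cleaning to the inspection number *)

Lemma cleanable_captures (G : sgraph) (r : G) t :
  cleanable r t ->
  exists2 s : seq {set G}, forall X, X \in s -> #|X| <= 3 &
    forall w : nat -> G, lazy_walk w -> captures s w.
Proof.
(* After [s0] only [r] can be contaminated, so one last inspection of [r] ends the game. *)
move=> [s0 [_ s0_card s0_clean]]; exists (rcons s0 [set r]).
  move=> X; rewrite mem_rcons inE => /predU1P[->|/s0_card//].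
  by rewrite cards1.
move=> w w_walk; apply: boolp.contrapT => w_free.
have free i : i < size (rcons s0 [set r]) ->
    w i \notin nth set0 (rcons s0 [set r]) i.
  by move=> i_lt; apply/negP=> wi; apply: w_free; exists i.
(* An intruder not yet caught sits in the contaminated set; the outside supply at [r] only enlarges
   that set. *)
have in_after i : i <= size s0 -> w i \in after [set r] setT (take i s0).
  elim: i => [|i IH] i_lt; first by rewrite take0 inE.
  rewrite (take_nth set0) // -cats1 after_cat /= !inE; apply/orP; right.
  apply/existsP; exists (w i); rewrite inE IH ?(ltnW i_lt) // andbT.
  have := free i; rewrite size_rcons nth_rcons i_lt ltnS ltnW // => -> //=.
  by case: (w_walk i) => ->; rewrite ?eqxx ?orbT.
have := in_after _ (leqnn _); rewrite take_size => /(subsetP s0_clean) wr.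
have := free (size s0); rewrite size_rcons nth_rcons ltnn eqxx ltnSn wr.
by move/(_ isT).
Qed.

(** The game demands exactly [k] vertices per turn, while the strategies bound the sizes from above;
    enlarging a set never hurts the searcher. *)
Lemma superset_card (T : finType) (X : {set T}) k :
  #|X| <= k <= #|T| -> exists2 Y : {set T}, X \subset Y & #|Y| = k.
Proof.
case/andP=> Xk kT; rewrite -(subnKC Xk) in kT *.
elim: (k - #|X|) kT => [_|m IH mT]; first by exists X; rewrite ?addn0.
have [|Y XY Ym] := IH; first by apply: leq_trans mT; rewrite leq_add2l.
have /properP[_ [y _ yY]] : Y \proper [set: T].
  by rewrite properEcard subsetT cardsT Ym -addnS.
exists (y |: Y); first exact: subset_trans XY (subsetUr _ _).
by rewrite cardsU1 yY Ym addnS.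
Qed.

Lemma inspection_number_le (G : sgraph) k (s : seq {set G}) :
  (forall X, X \in s -> #|X| <= k) ->
  (forall w : nat -> G, lazy_walk w -> captures s w) ->
  inspection_number G <= k.
Proof.
move=> s_card s_win; rewrite /inspection_number; case: ex_minnP => m _ m_min.
(* With at most [k] vertices there may be no set of size [k] to pad to; inspecting the whole graph
   then wins at once. *)
have [Gk|kG] := leqP #|G| k.
  apply: leq_trans Gk; apply/m_min/boolp.asboolP; exists [:: setT].
    by move=> X; rewrite inE => /eqP->; rewrite cardsT.
  by move=> w _; exists 0; rewrite //= in_setT.
apply/m_min/boolp.asboolP.
suff [s' s'_card s'_win] : exists2 s' : seq {set G},
    forall X, X \in s' -> #|X| = k &
    size s' = size s /\ forall i, nth set0 s i \subset nth set0 s' i.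
  exists s' => // w /s_win[i i_lt wi]; exists i; rewrite ?s'_win.1 //.
  exact: (subsetP (s'_win.2 i)).
elim: s s_card {s_win} => [|X s IH] s_card; first by exists [::].
have [|s' s'_card [s'_size s'_sub]] := IH.
  by move=> Y Ys; apply: s_card; rewrite inE Ys orbT.
have [|Y XY Yk] := @superset_card _ X k.
  by rewrite (ltnW kG) andbT s_card ?mem_head.
exists (Y :: s').
  by move=> Z; rewrite inE => /predU1P[->//|/s'_card].
by split=> [|[|i]] //=; rewrite s'_size.
Qed.

Lemma captures_iso (A B : sgraph) (f : A -> B) (s : seq {set B}) (w : nat -> A) :
  is_iso f -> (forall v : nat -> B, lazy_walk v -> captures s v) ->
  lazy_walk w -> captures (map (fun X : {set B} => f @^-1: X) s) w.
Proof.
move=> [_ f_adj] s_win w_walk.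
have [|i i_lt fwi] := s_win (f \o w).
  by move=> i /=; case: (w_walk i) => [->|wi]; [left | right; rewrite f_adj].
by exists i; rewrite ?size_map // (nth_map set0) // inE.
Qed.

Lemma card_preim_iso (A B : sgraph) (f : A -> B) (X : {set B}) :
  is_iso f -> #|f @^-1: X| = #|X|.
Proof. by move=> [f_bij _]; apply: on_card_preimset; exact: onW_bij. Qed.

Lemma tree_topologically_inspectable (T : sgraph) :
  is_tree T -> topologically_inspectable T 3.
Proof.
move=> T_tree H sub_H; have [T_gt0 _ _] := T_tree.
have [h h_built] : exists h : H, built h.
  apply: built_subdivision sub_H _; have [r _] := card_gt0P T_gt0.
  by exists r; exact: tree_built.
(* Radius 0 is enough, since nothing lies beyond the root of the whole tree. *)
have [A [a [t [sub_a a_clean _]]]] := built_cleanable h_built 0.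
have [s s_card s_win] := cleanable_captures a_clean.
have [H' [f [sub_H' f_iso]]] := rooted_subdivisionW sub_a.
exists H' => //.
apply: (@inspection_number_le _ _ (map (fun X : {set A} => f @^-1: X) s)).
  by move=> _ /mapP[X /s_card X3 ->]; rewrite (card_preim_iso _ f_iso).
by move=> w; exact: captures_iso.
Qed.

Theorem theorem1p1 (T : sgraph) (hT : is_tree T) :
  exists2 k : nat, is_topological_inspection_number T k & k <= 3.
Proof.
have insp3 := tree_topologically_inspectable hT.
have ex_k : exists k, boolp.asbool (topologically_inspectable T k).
  by exists 3; apply/boolp.asboolP.
case: (ex_minnP ex_k) => k /boolp.asboolP k_insp k_min.
exists k; last by apply/k_min/boolp.asboolP.
by split=> // j j_insp; apply/k_min/boolp.asboolP.
Qed.
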